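(* For every integer $m\ge2$ the following five conditions are equivalent. (1) $q(\mathcal{V}_m)>1$. (2) $2^m-1$ is not squarefree. (3) $L_m>1$. (4) $\mathcal{W}(m)\ne\varnothing$ or $G_m>1$. (5) There is an odd prime $p$ such that $d_p\mid m$ and ($p\mid m$ or $p\in\mathcal{W}$). In particular, $q(\mathcal{V}_m)\ne1$ for every $m\ge2$. If $\mathscr{H}=\{m\ge2: q(\mathcal{V}_m)>1\}$, then $$\mathscr{H}=\Bigl(\bigcup_{p\text{ odd prime}}p\,d_p\,\mathbb{N}\Bigr)\cup\Bigl(\bigcup_{p\in\mathcal{W}}d_p\,\mathbb{N}\Bigr),$$ where $\mathbb{N}=\{1,2,3,\dots\}$.
   Context: For $m\ge2$, $\mathcal{V}_m=(1,2^m-1,2^m)$. For a triple $(a,b,c)$ of positive integers with $a+b=c$, the quality is $q(a,b,c)=\log c/\log\mathrm{rad}(abc)$, where $\mathrm{rad}(n)$ is the product of the distinct primes dividing $n$. Put $L_m=(2^m-1)/\mathrm{rad}(2^m-1)$. For an odd prime $p$, $d_p$ is the multiplicative order of $2$ modulo $p$. $\mathcal{W}$ is the set of Wieferich primes, i.e. odd primes $p$ with $2^{p-1}\equiv1\pmod{p^2}$, and $\mathcal{W}(m)=\{p\in\mathcal{W}:p\mid2^m-1\}$. With $v_p$ the $p$-adic valuation, $G_m=\prod_{p\mid2^m-1}p^{v_p(m)}$ (product over primes $p$ dividing $2^m-1$). *)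

(* Defs.v *)
From HB Require Import structures.
From mathcomp Require Import all_boot all_order all_fingroup all_algebra.
From mathcomp Require Import all_classical reals exp.

Set Implicit Arguments.
Unset Strict Implicit.
Unset Printing Implicit Defensive.

Import Order.TTheory GRing.Theory Num.Theory.

Local Open Scope classical_set_scope.
Local Open Scope nat_scope.

Definition rad (n : nat) : nat := \prod_(p <- primes n) p.

Definition quality (R : realType) (t : nat * nat * nat) : R :=
  let: (a, b, c) := t in (ln c%:R / ln (rad (a * b * c))%:R)%R.

Definition V (m : nat) : nat * nat * nat := (1, 2 ^ m - 1, 2 ^ m).

Definition squarefree (n : nat) : Prop :=
  forall d : nat, d ^ 2 %| n -> d = 1.

(* The division is exact: rad n divides n whenever n > 0. *)
Definition L (m : nat) : nat := (2 ^ m - 1) %/ rad (2 ^ m - 1).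

Definition odd_prime (p : nat) : Prop := prime p /\ odd p.

(* The order of the class of 2 in the unit group of Z/pZ. The default value 1
   of insubd is used only when 2 is not invertible, which does not happen for
   an odd prime p. *)
Definition ord2 (p : nat) : nat :=
  #[insubd (1%g : {unit 'Z_p}) (2%:R : 'Z_p)%R]%g.

Definition wieferich : set nat :=
  [set p | odd_prime p /\ 2 ^ (p - 1) = 1 %[mod p ^ 2]].

Definition wieferich_dvd (m : nat) : set nat :=
  [set p | wieferich p /\ p %| 2 ^ m - 1].

Definition G (m : nat) : nat := \prod_(p <- primes (2 ^ m - 1)) p ^ logn p m.

Definition high_quality (R : realType) : set nat :=
  [set m | 2 <= m /\ (1 < quality R (V m))%R].

(* The set kN with N = {1, 2, 3, ...}. *)
Definition pos_multiples (k : nat) : set nat :=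
  [set k * j | j in [set j | 0 < j]].

(* Main.v *)
Require Import Defs.
From HB Require Import structures.
From mathcomp Require Import all_boot all_order all_fingroup all_algebra.
From mathcomp Require Import all_classical reals exp.
From mathcomp Require Import cyclic zify ring.

(** Write [N = 2 ^ m - 1] and let [d] be the order of 2 modulo [p], so that
    [p] divides [N] exactly when [d] divides [m] ([ord2_dvdP]).

    The quality only sees the size of the radical.  As [N] is odd, the radical
    of [1 * N * 2 ^ m] is [2 * rad N], so the quality is above, at or below 1
    according to the sign of [2 ^ m - 2 * rad N].  If the cofactor
    [L m] of [rad N] in [N] is 1, then [2 * rad N = 2 * N > 2 ^ m]; if it is at
    least 2, then [2 * rad N <= N < 2 ^ m] ([double_rad_mersenne]).  So the
    quality is never 1, and it exceeds 1 exactly when [L m > 1], that is, when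
    some [p ^ 2] divides [N] ([divn_rad_gt1P], [not_squarefreeP]).

    The arithmetic content is a criterion for [p ^ 2] to divide [N] when [p]
    does: either [p] divides [m] or [p] is a Wieferich prime
    ([sqr_dvd_mersenne]).  To see this, write [2 ^ m = 1 + p * u] and
    [2 ^ (p - 1) = 1 + p * w] and compute [2 ^ (m * (p - 1))] modulo [p ^ 2]
    in two ways, as [(1 + p * u) ^ (p - 1)] and as [(1 + p * w) ^ m].  Since
    [(1 + p * x) ^ k = 1 + p * (k * x)] modulo [p ^ 2], [p] divides
    [(p - 1) * u] exactly when it divides [m * w]; and [p] does not divide
    [p - 1].  This gives the equivalence with the conditions on [G m], on
    Wieferich divisors and on [d].

    The description of the set of all such [m] follows because [d] is coprime
    to [p] (it divides [p - 1]), so [p] and [d] both divide [m] exactly when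
    [p * d] does.  The multiples that occur are all at least 2 since
    [d > 1]. *)

Local Open Scope classical_set_scope.
Local Open Scope nat_scope.

(* Without qualification, this name would denote the radical of a form. *)
Local Notation rad := Defs.rad.

(** * Radicals and squarefree numbers *)

Lemma rad_gt0 n : 0 < rad n.
Proof.
rewrite /rad big_seq; apply: prodn_cond_gt0 => p.
by rewrite mem_primes => /andP[/prime_gt0].
Qed.

Lemma rad_coprimeM m n : 0 < m -> 0 < n -> coprime m n ->
  rad (m * n) = rad m * rad n.
Proof.
move=> m0 n0 cmn; rewrite /rad -big_cat; apply: perm_big.
apply: uniq_perm; first exact: primes_uniq.
  by rewrite cat_uniq !primes_uniq andbT /= -coprime_has_primes.
by move=> p; rewrite mem_cat primesM.
Qed.

Lemma rad_prime_power p k : prime p -> 0 < k -> rad (p ^ k) = p.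
Proof. by move=> pp k0; rewrite /rad primesX // primes_prime // big_seq1. Qed.

Lemma rad_mul_cofactor n : 0 < n ->
  rad n * \prod_(p <- primes n) p ^ (logn p n).-1 = n.
Proof.
move=> n0; rewrite [RHS]prod_prime_decomp // prime_decompE big_map /=.
rewrite -big_split /=; apply: eq_big_seq => p pn.
by rewrite -expnS prednK // logn_gt0.
Qed.

Lemma rad_dvd n : 0 < n -> rad n %| n.
Proof. by move=> n0; rewrite -{2}(rad_mul_cofactor n n0) dvdn_mulr. Qed.

Lemma divn_radE n : 0 < n ->
  n %/ rad n = \prod_(p <- primes n) p ^ (logn p n).-1.
Proof. by move=> n0; rewrite -{1}(rad_mul_cofactor n n0) mulKn // rad_gt0. Qed.

(** Both the cofactor of the radical and [G m] are products of this shape. *)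
Lemma prod_primes_gt1P n (e : nat -> nat) :
  reflect (exists2 p, p \in primes n & 0 < e p)
          (1 < \prod_(p <- primes n) p ^ e p).
Proof.
have pr p : p \in primes n -> prime p by rewrite mem_primes => /andP[].
apply: (iffP idP) => [|[p pn ep]].
  case: (altP (@hasP _ (fun p => 0 < e p) (primes n))) => [//|] /hasPn nh.
  rewrite big_seq big1 // => p /nh; rewrite -eqn0Ngt => /eqP ->.
  exact: expn0.
rewrite (big_rem p) //=.
have r0 : 0 < \prod_(q <- rem p (primes n)) q ^ e q.
  rewrite big_seq; apply: prodn_cond_gt0 => q /mem_rem/pr /prime_gt0 q0.
  by rewrite expn_gt0 q0.
apply: (@leq_trans (p ^ e p)); last by rewrite leq_pmulr.
by rewrite -{1}(expn0 p) ltn_exp2l ?prime_gt1 ?pr.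
Qed.

Lemma divn_rad_gt1P n : 0 < n ->
  reflect (exists2 p, prime p & p ^ 2 %| n) (1 < n %/ rad n).
Proof.
move=> n0; rewrite divn_radE //.
apply: (iffP (prod_primes_gt1P _ _)) => [[p]|[p pp p2]].
  rewrite mem_primes => /and3P[pp _ _] l; exists p => //.
  by rewrite pfactor_dvdn //; lia.
move: p2; rewrite pfactor_dvdn // => p2; exists p; last lia.
by rewrite -logn_gt0; lia.
Qed.

(** A square divisor other than 1 contains the square of any of its primes;
    positivity of [n] excludes the divisor 0. *)
Lemma not_squarefreeP n : 0 < n ->
  ~ squarefree n <-> exists2 p, prime p & p ^ 2 %| n.
Proof.
move=> n0; split=> [|[p pp p2] /(_ p p2) p1]; last by rewrite p1 in pp.
apply: contra_notP => np d d2; apply/eqP/negPn/negP => d1; apply: np.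
have d0 : 0 < d by case: d d2 {d1} => //; rewrite dvd0n => /eqP n00; lia.
exists (pdiv d); first by rewrite pdiv_prime; lia.
by apply: dvdn_trans d2; rewrite dvdn_exp2r // pdiv_dvd.
Qed.

(** * Divisibility of a power minus one by the square of a prime *)

(** The binomial expansion of the left side has all its further terms
    divisible by [n ^ 2]. *)
Lemma expn_1D_mod_sqr n u k : (1 + n * u) ^ k = 1 + n * (k * u) %[mod n ^ 2].
Proof.
elim: k => [|k IH]; first by rewrite mul0n muln0.
rewrite expnS -modnMmr IH modnMmr.
have -> : (1 + n * u) * (1 + n * (k * u)) =
          u * (k * u) * n ^ 2 + (1 + n * (k.+1 * u)) by ring.
by rewrite modnMDl.
Qed.

Lemma sqr_dvd_expn_1D n u k : 0 < n ->
  (n ^ 2 %| (1 + n * u) ^ k - 1) = (n %| k * u).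
Proof.
move=> n0; rewrite -(@eqn_mod_dvd _ _ 1) ?expn_gt0 //.
rewrite expn_1D_mod_sqr eqn_mod_dvd ?addKn ?leq_addr //.
by rewrite -mulnn dvdn_pmul2l.
Qed.

Lemma fermat_dvd p a : prime p -> coprime a p -> p %| a ^ (p - 1) - 1.
Proof.
move=> pp cap; have a0 : 0 < a.
  by case: a cap => //; rewrite /coprime gcd0n; case: p pp => [|[]].
rewrite -eqn_mod_dvd ?expn_gt0 ?a0 // -(Euler_exp_totient cap).
by rewrite totient_prime // subn1.
Qed.

(** The two ways of computing [a ^ (m * (p - 1))] modulo [p ^ 2], from
    [a ^ m] and from [a ^ (p - 1)], tie the two divisibilities by [p ^ 2]
    together, since [p] does not divide [p - 1]. *)
Lemma sqr_dvd_expn_sub1 p a m : prime p -> p %| a ^ m - 1 -> coprime a p ->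
  (p ^ 2 %| a ^ m - 1) = (p %| m) || (p ^ 2 %| a ^ (p - 1) - 1).
Proof.
move=> pp pm cap; have p0 := prime_gt0 pp.
have a0 : 0 < a.
  by case: a cap {pm} => //; rewrite /coprime gcd0n; case: p pp {p0} => [|[]].
have /dvdnP[u um] := pm; have /dvdnP[w wm] := fermat_dvd p a pp cap.
have Eu : a ^ m = 1 + p * u.
  by rewrite mulnC -um subnKC // expn_gt0 a0.
have Ew : a ^ (p - 1) = 1 + p * w.
  by rewrite mulnC -wm subnKC // expn_gt0 a0.
have sq v : (p ^ 2 %| 1 + p * v - 1) = (p %| v).
  by rewrite addKn -mulnn dvdn_pmul2l.
have pN : (p %| p - 1) = false.
  by have := prime_gt1 pp => p1; apply: gtnNdvd; lia.
(* Both sides say that [p ^ 2] divides [a ^ (m * (p - 1)) - 1]. *)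
have : (p %| (p - 1) * u) = (p %| m * w).
  by rewrite -!sqr_dvd_expn_1D // -Eu -Ew -!expnM (mulnC m).
by rewrite !Euclid_dvdM // pN Eu Ew !sq.
Qed.

(** * The order of 2 and Wieferich primes *)

Lemma odd_prime_coprime2 p : odd_prime p -> coprime 2 p.
Proof. by case=> _ po; rewrite coprime2n. Qed.

(** As 2 is invertible modulo [p], the default value in [ord2] is not taken,
    and [2 ^ k] is 1 in the unit group exactly when it is 1 modulo [p]. *)
Lemma ord2_dvdP p k : odd_prime p -> (ord2 p %| k) = (p %| 2 ^ k - 1).
Proof.
move=> op; have [pp po] := op; have p1 := prime_gt1 pp.
rewrite /ord2 order_dvdn -(inj_eq val_inj) FinRing.val_unitX /=.
rewrite insubdK; last first.
  by rewrite unfold_in unitZpE // coprime_sym odd_prime_coprime2.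
rewrite -eqn_mod_dvd ?expn_gt0 // -GRing.natrX.
rewrite -[X in (_ == X)%R = _](GRing.mulr1n 1%R).
by rewrite -(inj_eq val_inj) /= val_Zp_nat // Zp_cast.
Qed.

Lemma ord2_gt1 p : odd_prime p -> 1 < ord2 p.
Proof.
move=> op; have p2 : 2 < p by case: op => pp po; exact: odd_prime_gt2.
(* Order 1 would mean that [p] divides [2 ^ 1 - 1]. *)
rewrite ltn_neqAle order_gt0 andbT eq_sym; apply/eqP => o1.
have := ord2_dvdP p 1 op; rewrite o1 dvdnn expn1 dvdn1 => /esym/eqP; lia.
Qed.

(** By Fermat the order divides [p - 1]. *)
Lemma coprime_ord2 p : odd_prime p -> coprime p (ord2 p).
Proof.
move=> op; have [pp po] := op; rewrite prime_coprime //.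
have : ord2 p %| p - 1.
  by rewrite ord2_dvdP // fermat_dvd // odd_prime_coprime2.
have p2 := odd_prime_gt2 po pp.
move=> od; apply/negP => /dvdn_trans/(_ od).
by apply/negP; rewrite gtnNdvd; lia.
Qed.

Lemma wieferichP p : odd_prime p -> wieferich p <-> p ^ 2 %| 2 ^ (p - 1) - 1.
Proof.
move=> op; rewrite -eqn_mod_dvd ?expn_gt0 //.
by split=> [[_ /eqP]|/eqP].
Qed.

Lemma odd_mersenne m : 0 < m -> odd (2 ^ m - 1).
Proof. by move=> m0; rewrite oddB ?expn_gt0 // oddX; case: m m0. Qed.

Lemma dvd_mersenne_odd_prime p m : 0 < m -> prime p -> p %| 2 ^ m - 1 ->
  odd_prime p.
Proof. by move=> m0 pp /dvdn_odd; split=> //; auto using odd_mersenne. Qed.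

Lemma sqr_dvd_mersenne p m : odd_prime p ->
  p ^ 2 %| 2 ^ m - 1 <->
  p %| 2 ^ m - 1 /\ (p %| m \/ wieferich p).
Proof.
move=> op; have [pp _] := op; rewrite wieferichP //.
have E := sqr_dvd_expn_sub1 p 2 m pp ^~ (odd_prime_coprime2 p op).
split=> [p2|[/E -> /orP //]].
have pm : p %| 2 ^ m - 1 by apply: dvdn_trans p2; rewrite dvdn_exp.
by split=> //; apply/orP; rewrite -E.
Qed.

(** * The quality as a comparison of integers *)

Lemma rad_V m : 0 < m ->
  rad (1 * (2 ^ m - 1) * 2 ^ m) = 2 * rad (2 ^ m - 1).
Proof.
move=> m0; have om := odd_mersenne m m0.
rewrite mul1n rad_coprimeM ?expn_gt0 ?(odd_gt0 om) //.
  by rewrite rad_prime_power // mulnC.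
by rewrite coprimeXr ?coprimen2.
Qed.

Section Quality.
Variable R : realType.
Import Order.TTheory GRing.Theory Num.Theory.

Lemma ln_nat_ratio_gt1 c r : 1 < c -> 1 < r ->
  ((1 < ln (c%:R : R) / ln (r%:R : R))%R = (r < c)) /\
  (ln (c%:R : R) / ln (r%:R : R) = 1 -> r = c)%R.
Proof.
move=> c1 r1.
have lr : (0 < ln (r%:R : R))%R by rewrite ln_gt0 // ltr1n.
have cp : (c%:R : R)%R \is Num.pos by rewrite posrE ltr0n; lia.
have rp : (r%:R : R)%R \is Num.pos by rewrite posrE ltr0n; lia.
split; first by rewrite ltr_pdivlMr // mul1r ltr_ln // ltr_nat.
move/(congr1 (fun x => x * ln r%:R)%R); rewrite divfK ?gt_eqF // mul1r.
by move/(ln_inj cp rp)/eqP; rewrite eqr_nat => /eqP.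
Qed.

Lemma quality_V_cmp m : 0 < m ->
  ((1 < quality R (V m))%R = (2 * rad (2 ^ m - 1) < 2 ^ m)) /\
  (quality R (V m) = 1%R -> 2 * rad (2 ^ m - 1) = 2 ^ m).
Proof.
move=> m0; rewrite /quality /V rad_V //.
apply: ln_nat_ratio_gt1; first by rewrite -{1}(expn0 2) ltn_exp2l.
have := rad_gt0 (2 ^ m - 1); lia.
Qed.
End Quality.

(** Doubling leaps over [2 ^ m]: with [N = 2 ^ m - 1], the radical is either
    [N], whose double is beyond [2 ^ m], or a proper divisor of [N], whose
    double is at most [N]. *)
Lemma double_rad_mersenne m : 2 <= m ->
  (2 * rad (2 ^ m - 1) < 2 ^ m) = (1 < L m) /\ 2 * rad (2 ^ m - 1) <> 2 ^ m.
Proof.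
move=> m2; have m4 : 2 ^ 2 <= 2 ^ m by rewrite leq_exp2l.
have n0 : 0 < 2 ^ m - 1 by lia.
have r0 := rad_gt0 (2 ^ m - 1).
have LE : L m * rad (2 ^ m - 1) = 2 ^ m - 1 by rewrite divnK // rad_dvd.
case: (L m) LE => [|[|l]] LE; first by lia.
  by rewrite ltnn mul1n in LE *; split; last move=> eq2r; lia.
have lt2r : 2 * rad (2 ^ m - 1) < 2 ^ m by nia.
by rewrite lt2r; split=> // eq2r; rewrite eq2r ltnn in lt2r.
Qed.

(** * The equivalences *)

Lemma pos_multiplesP k m : 0 < k -> pos_multiples k m <-> k %| m /\ 0 < m.
Proof.
move=> k0; split=> [[j /= j0 <-]|[/dvdnP[j ->]]].
  by rewrite dvdn_mulr // muln_gt0 k0.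
by rewrite muln_gt0 => /andP[j0 _]; exists j; rewrite //= mulnC.
Qed.

Theorem theorem6p19 (R : realType) :
  (forall m : nat, 2 <= m ->
     [<-> (1 < quality R (V m))%R;
          ~ squarefree (2 ^ m - 1);
          1 < L m;
          wieferich_dvd m !=set0 \/ 1 < G m;
          exists p : nat, [/\ odd_prime p, ord2 p %| m &
                              p %| m \/ wieferich p]]) /\
  (forall m : nat, 2 <= m -> quality R (V m) <> 1%R) /\
  high_quality R =
    (\bigcup_(p in [set p | odd_prime p]) pos_multiples (p * ord2 p)) `|`
    (\bigcup_(p in wieferich) pos_multiples (ord2 p)).
Proof.
have equiv m : 2 <= m ->
     [<-> (1 < quality R (V m))%R;
          ~ squarefree (2 ^ m - 1);
          1 < L m;
          wieferich_dvd m !=set0 \/ 1 < G m;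
          exists p : nat, [/\ odd_prime p, ord2 p %| m &
                              p %| m \/ wieferich p]].
  move=> m2; have m0 := ltnW m2.
  have n0 : 0 < 2 ^ m - 1 by rewrite odd_gt0 // odd_mersenne.
  have qL : (1 < quality R (V m))%R = (1 < L m).
    by rewrite (quality_V_cmp R m m0).1 (double_rad_mersenne m m2).1.
  tfae.
  - by rewrite qL not_squarefreeP // => /(divn_rad_gt1P _ n0).
  - by rewrite not_squarefreeP // => /(divn_rad_gt1P _ n0).
  - case/(divn_rad_gt1P _ n0) => p pp p2.
    have pn : p %| 2 ^ m - 1 by apply: dvdn_trans p2; rewrite dvdn_exp.
    have op := dvd_mersenne_odd_prime p m m0 pp pn.
    have [_ [pm|pw]] := (sqr_dvd_mersenne p m op).1 p2.
      right; apply/prod_primes_gt1P; exists p; first by rewrite mem_primes pp n0.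
      by rewrite logn_gt0 mem_primes pp m0.
    by left; exists p.
  - case=> [[p [pw pn]]|/prod_primes_gt1P[p]].
      by exists p; have [op _] := pw; rewrite ord2_dvdP //; split=> //; right.
    rewrite mem_primes logn_gt0 mem_primes => /and3P[pp _ pn] /and3P[_ _ pm].
    have op := dvd_mersenne_odd_prime p m m0 pp pn.
    by exists p; rewrite ord2_dvdP //; split=> //; left.
  - case=> p [op]; rewrite ord2_dvdP // => pn pmw.
    rewrite qL; apply/(divn_rad_gt1P _ n0); exists p; first by case: op.
    by apply/sqr_dvd_mersenne.
split=> //; split.
  move=> m m2 /(quality_V_cmp R m (ltnW m2)).2.
  exact: (double_rad_mersenne m m2).2.
have highP m : high_quality R m <-> 2 <= m /\
    exists p, [/\ odd_prime p, ord2 p %| m & p %| m \/ wieferich p].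
  by split=> -[m2 h]; split=> //; apply/(equiv m m2 0 4).
have d0 p : odd_prime p -> 0 < ord2 p by move=> /ord2_gt1 /ltnW.
have pd0 p : odd_prime p -> 0 < p * ord2 p.
  by move=> op; rewrite muln_gt0 d0 // prime_gt0 //; case: op.
have ge2 p m : odd_prime p -> ord2 p %| m -> 0 < m -> 2 <= m.
  move=> /ord2_gt1 o1 om m0; exact: leq_trans o1 (dvdn_leq m0 om).
apply/seteqP; split=> m.
  case/highP=> m2 [p [op om [pm|pw]]]; [left|right]; exists p => //.
    apply/pos_multiplesP; first exact: pd0.
    by rewrite Gauss_dvd ?pm ?om ?coprime_ord2 //; split; lia.
  by apply/pos_multiplesP; [exact: d0|split=> //; lia].
case=> [[p op]|[p pw]].
  move/(pos_multiplesP _ _ (pd0 p op)) => [pom m0]; apply/highP.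
  have om := dvdn_trans (dvdn_mull p (dvdnn _)) pom.
  split; first exact: ge2 om m0.
  by exists p; split=> //; left; apply: dvdn_trans pom; rewrite dvdn_mulr.
have [op _] := pw.
move/(pos_multiplesP _ _ (d0 p op)) => [om m0]; apply/highP.
split; first exact: ge2 om m0.
by exists p; split=> //; right.
Qed.
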